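(* Let $L=(V,E)$ be a connected simple graph on $\bar{n}=|V|$ vertices and $k\in\{1,\dots,\bar{n}-1\}$. The graph $L$ is bipartite if and only if $\mathfrak{L}_k$ is bipartite.
   Context: For a finite simple graph $L=(V,E)$ and $k\in\{1,\dots,|V|-1\}$, the $k$-particle graph $\mathfrak{L}_k=(\mathfrak{V}_k,\mathfrak{E}_k)$ has vertex set $\mathfrak{V}_k$ consisting of all subsets of $V$ of size $k$, and $\langle\mathfrak{v},\mathfrak{w}\rangle\in\mathfrak{E}_k$ if and only if $\mathfrak{v}\triangle\mathfrak{w}=\{v,w\}$ with $\langle v,w\rangle\in E$. *)

(* Defs.v *)
From mathcomp Require Import all_boot.

Set Implicit Arguments.
Unset Strict Implicit.
Unset Printing Implicit Defensive.

Record sgraph := SGraph {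
  vertex :> finType;
  edge : rel vertex;
  edge_sym : symmetric edge;
  edge_irr : irreflexive edge }.

(* The graph without vertices counts as connected here. *)
Definition connected_graph (L : sgraph) : Prop :=
  forall x y : L, connect (@edge L) x y.

(* One of the two classes may be empty. *)
Definition bipartite (L : sgraph) : Prop :=
  exists A B : {set L},
    [/\ A :|: B = [set: L], A :&: B = set0
      & forall x y : L, edge x y ->
          (x \in A /\ y \in B) \/ (x \in B /\ y \in A)].

Definition symdiff (T : finType) (A B : {set T}) : {set T} :=
  (A :\: B) :|: (B :\: A).

Section ParticleGraph.
Variables (L : sgraph) (k : nat).

Definition kset : finType := {A : {set L} | #|A| == k}.

Definition particle_edge : rel kset := fun a b =>
  [exists v : L, exists w : L,
     edge v w && (symdiff (val a) (val b) == [set v; w])].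

Lemma particle_edge_sym : symmetric particle_edge.
Proof.
by move=> a b; rewrite /particle_edge /symdiff setUC.
Qed.

Lemma particle_edge_irr : irreflexive particle_edge.
Proof.
move=> a; apply/existsP => -[v /existsP[w /andP[_ /eqP]]].
by rewrite /symdiff setDv setU0 => /setP/(_ v); rewrite !inE eqxx.
Qed.

Definition particle_graph : sgraph :=
  SGraph particle_edge_sym particle_edge_irr.

End ParticleGraph.

(* Main.v *)
(** Forward direction: if [A] is one side of a bipartition of [L], moving a
    particle along an edge changes the parity of the number of particles in [A].

    Backward direction: let [c] be a 2-colouring of the [k]-subsets, and fix a
    vertex [w].  If a walk of length [l] from [v] meets [w] only at its end and
    [S] contains [v] but not [w], then [S] can be turned into [S - v + w] by [l]
    particle moves: whenever the next vertex of the walk is occupied, the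
    particle sitting there is first sent to [w].  Hence the parity of [l] is
    determined by [c], [S] and [v], and this parity 2-colours [L]. *)
Require Import Defs.
From mathcomp Require Import all_boot.

Set Implicit Arguments.
Unset Strict Implicit.
Unset Printing Implicit Defensive.

Lemma bipartiteP (L : sgraph) :
  bipartite L <-> exists c : L -> bool, forall x y, edge x y -> c x = ~~ c y.
Proof.
split=> [[A [B [_ AB0 eAB]]]|[c ec]].
  exists (fun x => x \in A) => x y /eAB.
  have notAB z : z \in B -> z \in A = false.
    by move=> zB; apply/negP => zA; have := in_set0 z; rewrite -AB0 inE zA zB.
  by case=> [[-> /notAB ->]|[/notAB -> ->]].
exists [set x | c x], [set x | ~~ c x]; split.
- by apply/setP => x; rewrite !inE orbN.
- by apply/setP => x; rewrite !inE andbN.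
- by move=> x y /ec cxy; rewrite !inE cxy; case: (c y); [right|left].
Qed.

(** The points of [A :&: B :&: C] are counted twice on the right, so they cancel modulo 2. *)
Lemma odd_card_symdiffI (T : finType) (A B C : {set T}) :
  odd #|symdiff A B :&: C| = odd #|A :&: C| (+) odd #|B :&: C|.
Proof.
rewrite /symdiff setIUl cardsU.
have -> : (A :\: B) :&: C :&: ((B :\: A) :&: C) = set0.
  by apply/setP => x; rewrite !inE; case: (x \in A); case: (x \in B); rewrite ?andbF.
rewrite cards0 subn0 oddD !setIDAC -(cardsID B (A :&: C)) -(cardsID A (B :&: C)) !oddD.
have -> : B :&: C :&: A = A :&: C :&: B by rewrite setIC setIA setIAC.
by rewrite addbACA addbb addFb.
Qed.

Lemma bipartite_particle_graph (L : sgraph) (k : nat) :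
  bipartite L -> bipartite (particle_graph L k).
Proof.
move=> /bipartiteP[c ec]; apply/bipartiteP.
pose C := [set x | c x].
exists (fun S : particle_graph L k => odd #|val S :&: C|) => S T.
move=> /existsP[v /existsP[w /andP[vw /eqP STvw]]].
have := odd_card_symdiffI (val S) (val T) C; rewrite STvw.
(* The ends of an edge have different colours, so exactly one of them lies in [C]. *)
have -> : [set v; w] :&: C = [set if c v then v else w].
  have := ec _ _ vw; case cv: (c v); case cw: (c w) => // _.
  - apply/setP => x; rewrite !inE; have [->|_] := eqVneq x v; first by rewrite cv.
    by have [->|_] := eqVneq x w; rewrite ?cw.
  - apply/setP => x; rewrite !inE orbC; have [->|_] := eqVneq x w; first by rewrite cw.
    by have [->|_] := eqVneq x v; rewrite ?cv.
by rewrite cards1 [odd 1]/=; case: (odd _); case: (odd _).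
Qed.

Lemma exists_separating_kset (T : finType) (k : nat) (v w : T) :
  v != w -> 1 <= k <= #|T| - 1 ->
  exists S : {set T}, [/\ #|S| = k, v \in S & w \notin S].
Proof.
move=> vw /andP[k_gt0 k_le].
(* The other [k.-1] elements of [S] must avoid both [v] and [w]; the upper bound on [k] leaves room
   for them. *)
have : k.-1 <= #|~: [set v; w]|.
  have := cardsC [set v; w]; rewrite cards2 vw => cT.
  by rewrite -ltnS prednK // (leq_trans k_le) // -cT addSn add1n subn1.
case/card_geqP=> s [us ss sub].
have sN x : x \in s -> (x != v) && (x != w).
  by move/sub; rewrite !inE negb_or.
exists (v |: [set x in s]); split.
- rewrite cardsU1 inE; case: (boolP (v \in s)) => [/sN|_]; first by rewrite eqxx.
  by rewrite cardsE (card_uniqP us) ss add1n prednK.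
- by rewrite setU11.
- rewrite !inE negb_or eq_sym vw /=.
  by apply/negP => /sN; rewrite eqxx andbF.
Qed.

Section WalkParity.
Variables (L : sgraph) (k : nat) (c : {set L} -> bool).
Hypothesis c_move : forall (S : {set L}) (v w : L), #|S| = k ->
  v \in S -> w \notin S -> edge v w -> c (w |: S :\ v) = ~~ c S.

Lemma card_swap (S : {set L}) (v w : L) :
  v \in S -> w \notin S -> #|w |: S :\ v| = #|S|.
Proof.
by move=> vS wS; rewrite cardsU1 !inE (negPf wS) andbF (cardsD1 v S) vS.
Qed.

Lemma walk_parity (w v : L) (p : seq L) (S : {set L}) :
  path (@edge L) v p -> last v p = w -> w \notin belast v p ->
  #|S| = k -> v \in S -> w \notin S ->
  odd (size p) = c S (+) c (w |: S :\ v).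
Proof.
elim: p v S => [|u p IHp] v S /=; first by move=> _ -> _ _ ->.
case/andP=> vu up lastw; rewrite inE negb_or => /andP[wv wp] Sk vS wS.
have uv : u != v by apply/eqP => uv; rewrite uv edge_irr in vu.
case: (boolP (u \in S)) => [uS|uS].
  have uw : u != w by apply: contraNneq wS => <-.
  rewrite (IHp _ _ up lastw wp Sk uS wS).
  (* The induction hypothesis has sent the particle at [u] to [w]; now [u] is free and the particle
     at [v] moves there. *)
  have := @c_move (w |: S :\ u) v u.
  rewrite card_swap // !inE eqxx vS (negPf uw) [v == u]eq_sym uv orbT /=.
  have -> : u |: (w |: S :\ u) :\ v = w |: S :\ v.
    apply/setP => x; rewrite !inE.
    have [->|xu] := eqVneq x u; first by rewrite uv uS orbT.
    have [->|xw] //= := eqVneq x w; by rewrite wv.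
  by move=> -> //; rewrite addbN.
have cS := c_move Sk vS uS vu.
(* If the walk ends at [u], then [u = w] and the single move is the claim. The induction hypothesis
   would fail here, since the moved set contains [w]. *)
case: p IHp up lastw wp => [_ _ /= uw _|t p IHp up lastw wp].
  by rewrite -uw cS addbN addbb.
have uw : w != u by apply: contraNneq wp => ->; rewrite mem_head.
rewrite (IHp _ (u |: S :\ v) up lastw wp) ?card_swap //.
- rewrite cS; have -> : (u |: S :\ v) :\ u = S :\ v.
    by rewrite setU1K // !inE (negPf uS) andbF.
  by rewrite addNb negbK.
- by rewrite setU11.
- by rewrite !inE (negPf uw) (negPf wS) andbF.
Qed.

Lemma bipartite_of_moves :
  connected_graph L -> 1 <= k <= #|L| - 1 -> bipartite L.
Proof.
move=> conL kL; apply/bipartiteP.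
have /card_gt0P[w _] : 0 < #|L|.
  by case: #|L| kL => //; rewrite sub0n => /andP[/leq_trans H /H].
pose P v b := forall p, path (@edge L) v p -> last v p = w ->
  w \notin belast v p -> odd (size p) = b.
have [f fE] : exists f : L -> bool, forall v, P v (f v).
  apply: fin_all_exists => v; rewrite /P; have [->|vw] := eqVneq v w.
    (* From [w] itself only the empty walk avoids [w] before its end. *)
    by exists false => -[|u p] //=; rewrite mem_head.
  have [S [Sk vS wS]] := exists_separating_kset vw kL.
  by exists (c S (+) c (w |: S :\ v)) => p vp pw wp; apply: walk_parity.
have step x y : edge x y -> x != w -> f x = ~~ f y.
  move=> xy xw; have /connectP[p0 yp0 w0] := conL y w.
  (* A walk without repeated vertices meets [w] only at its end. *)
  case/shortenP: yp0 w0 => p yp up _ wE.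
  have wp : w \notin belast y p.
    by move: up; rewrite lastI rcons_uniq -wE => /andP[].
  rewrite -(fE y p) // -(fE x (y :: p)) //= ?xy //.
  by rewrite inE negb_or eq_sym xw.
exists f => x y xy; have [xw|] := eqVneq x w; last exact: step.
rewrite (step y x) ?negbK //; first by rewrite edge_sym.
by apply/eqP => yw; rewrite xw yw edge_irr in xy.
Qed.

End WalkParity.

Theorem theorem3p2 (L : sgraph) (k : nat) :
  connected_graph L -> 1 <= k <= #|L| - 1 ->
  (bipartite L <-> bipartite (particle_graph L k)).
Proof.
move=> conL kL; split; first exact: bipartite_particle_graph.
case/bipartiteP=> c ec.
apply: (@bipartite_of_moves L k
  (* The value [false] on sets of other sizes is never consulted, as moves preserve cardinality. *)
  (fun S => if insub S is Some a then c (a : kset L k) else false)) => //.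
move=> S v w Sk vS wS vw.
have Sk' : #|S| == k by apply/eqP.
have Tk : #|w |: S :\ v| == k by rewrite card_swap.
rewrite (insubT (fun A : {set L} => #|A| == k) Sk').
rewrite (insubT (fun A : {set L} => #|A| == k) Tk).
apply: ec; apply/existsP; exists v; apply/existsP; exists w.
rewrite vw /=; apply/eqP/setP => x; rewrite /symdiff !inE.
have [->|xv] := eqVneq x v.
  by rewrite vS /= orbF; case: eqVneq vS wS => //= <- ->.
have [->|xw] := eqVneq x w; first by rewrite (negPf wS).
by case: (x \in S).
Qed.
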